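(* Fix $\mathbf{w}_1\in\mathbb{C}^{N_d}$. Consider the problem $$\text{(P1)}\qquad \max_{\mathbf{Q}}\ \zeta\sum_{m=1}^{M}\alpha_m\left|\mathbf{a}_m^H\,\mathbf{H}\mathbf{Q}\,\mathbf{w}_1\right|^2$$ over all matrices $\mathbf{Q}\in\mathbb{C}^{N\times N_d}$ with entries $\mathbf{Q}_{(i-1)N_e+l,\,n}=q_{i,l}$ if $i=n$ and $0$ if $i\neq n$ ($1\le i,n\le N_d$, $1\le l\le N_e$), where $q_{i,l}\in\mathcal{Q}$ for all $i,l$. Let $\mathbf{q}=\mathrm{vec}(\mathbf{Q})\in\mathbb{C}^{N_d^2N_e}$ and $\mathbf{z}_m=\left(\mathbf{w}_1^T\otimes(\mathbf{a}_m^H\mathbf{H})\right)^H\in\mathbb{C}^{N_d^2N_e}$ for $m=1,\dots,M$. Let $\mathcal{A}_q$ be the set of the $N$ positions of $\mathbf{q}$ that are not forced to be zero by the structure of $\mathbf{Q}$ (i.e. the positions of the entries $q_{i,l}$), and let $\bar{\mathbf{q}}$ and $\bar{\mathbf{z}}_m$ be the vectors in $\mathbb{C}^N$ obtained from $\mathbf{q}$ and $\mathbf{z}_m$, respectively, by deleting all entries whose positions are not in $\mathcal{A}_q$. Define $\mathbf{A}(\mathbf{w}_1)=-\zeta\sum_{m=1}^{M}\alpha_m\,\bar{\mathbf{z}}_m\bar{\mathbf{z}}_m^H\in\mathbb{C}^{N\times N}$. Then (P1) is equivalent to the problem $$\text{(P2)}\qquad \min_{\bar{\mathbf{q}}\in\mathbb{C}^{N}}\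 \bar{\mathbf{q}}^H\,\mathbf{A}(\mathbf{w}_1)\,\bar{\mathbf{q}}\quad\text{s.t.}\quad \bar q_l\in\mathcal{Q}\ \text{ for all } l\in\mathcal{A}_q,$$ in the sense that they achieve the same optimal value up to the sign change between maximization and minimization, i.e. the optimal value of (P1) equals the negative of the optimal value of (P2).
   Context: $N_d,N_e,M\ge 1$ are integers (numbers of microstrips, of elements per microstrip, and of energy receivers) and $N=N_dN_e$. $\mathrm{vec}(\cdot)$ is column-stacking vectorization, $\otimes$ the Kronecker product, $(\cdot)^T$ the transpose, $(\cdot)^H$ the Hermitian transpose, and $j$ the imaginary unit. $0<\zeta<1$ is the energy conversion efficiency and $\alpha_1,\dots,\alpha_M$ are predefined real weights. The entries of $\bar{\mathbf{q}}$ and $\bar{\mathbf{z}}_m$ are indexed by $\mathcal{A}_q$ (in increasing order). The Lorentzian-constrained set of element responses is $\mathcal{Q}=\{\tfrac{j+e^{j\phi}}{2}:\phi\in[0,2\pi]\}$. $\mathbf{H}\in\mathbb{C}^{N\times N}$ is the diagonal matrix whose $((i-1)N_e+l)$-th diagonal entry is $h_{i,l}=e^{-\rho_{i,l}(\alpha_{\rm c}+j\beta_{\rm c})}$, with real constants $\alpha_{\rm c},\beta_{\rm c}$ and real $\rho_{i,l}$ (location of the $l$-th element in the $i$-th microstrip). Channel vectors: element $(i,l)$ is located at $\mathbf{p}_{i,l}=(x_i,y_l,0)\in\mathbb{R}^3$ and receiver $m$ at $\mathbf{p}_m\in\mathbb{R}^3$; $d_{i,l,m}=|\mathbf{p}_m-\mathbf{p}_{i,l}|>0$.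 With wavelength $\lambda>0$ and $k=2\pi/\lambda$, $\mathbf{a}_m\in\mathbb{C}^N$ is the column vector for which $\mathbf{a}_m^H$ is the row vector with $((i-1)N_e+l)$-th entry $A_{i,l}(\mathbf{p}_m)e^{-jkd_{i,l,m}}$, where $A_{i,l}(\mathbf{p}_m)=\sqrt{F(\Theta_{i,l,m})}\,\frac{\lambda}{4\pi d_{i,l,m}}$ and $\Theta_{i,l,m}=(\theta_{i,l,m},\phi_{i,l,m})$ is the elevation-azimuth pair from element $(i,l)$ to receiver $m$. The radiation profile is $F(\Theta_{i,l,m})=2(b+1)\cos^b(\theta_{i,l,m})$ if $\theta_{i,l,m}\in[0,\pi/2]$ and $0$ otherwise, with boresight gain constant $b$ (e.g. $b=2$). *)

(* Defs.v *)
From HB Require Import structures.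
From mathcomp Require Import all_boot all_order all_algebra.
From mathcomp Require Import complex mxtens.
From mathcomp Require Import all_classical all_reals all_analysis.

Set Implicit Arguments.
Unset Strict Implicit.
Unset Printing Implicit Defensive.

Import Order.TTheory GRing.Theory Num.Theory.

Local Open Scope classical_set_scope.
Local Open Scope complex_scope.
Local Open Scope sesquilinear_scope.
Local Open Scope ring_scope.

Section ComplexExponential.
Context {R : realType}.

Definition cexp (z : R[i]) : R[i] :=
  (expR (complex.Re z))%:C * (cos (complex.Im z) +i* sin (complex.Im z)).

Definition lorentz_set : set R[i] :=
  [set ('i%C + cexp ('i%C * phi%:C)) / 2 | phi in `[0, 2 * pi]%classic].

End ComplexExponential.

(* mxvec_index is defined through enum_rank; its value agrees with mxtens_index,
   hence with the indexing of the Kronecker product *t. *)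
Lemma val_mxvec_index m n (i : 'I_m) (j : 'I_n) : mxvec_index i j = (i * n + j)%N :> nat.
Proof.
rewrite /=.
rewrite [X in X = _](_ : _ = index (i,j) (enum {: 'I_m * 'I_n})); last first.
  apply/eqP; rewrite -(nth_uniq (i,j) _ _ (enum_uniq {: 'I_m * 'I_n})) ?index_mem ?mem_enum //.
    by rewrite nth_index ?mem_enum // nth_enum_rank.
  by rewrite -cardE.
rewrite enumT unlock /= /prod_enum /=.
have H s : i \in s -> uniq s -> index (i, j) [seq (x1, x2) | x1 <- s, x2 <- enum 'I_n] = (index i s * n + j)%N.
  elim: s => //= x s IH; rewrite inE index_cat size_map size_enum_ord.
  case: (eqVneq x i) => [-> _ _|ne].
    rewrite mem_map; last by move=> ? ? [].
    by rewrite mem_enum /= (@index_map _ _ (pair i)) ?index_enum_ord // => ? ? [].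
  case: mapP => [[z _ [e _]]|_]; first by rewrite e eqxx in ne.
  move=> /= h /andP[_ u].
  by rewrite IH // mulSn addnA.
by rewrite H ?mem_enum ?enum_uniq // index_enum_ord.
Qed.

Section OptimalValues.
Context {d : Order.disp_t} {T : porderType d}.

(* On R[i], x <= y means Im x = Im y and Re x <= Re y, so that for a real v
   these predicates also assert that all the values in S are real. *)
Definition is_max_value (S : set T) (v : T) : Prop := S v /\ ubound S v.
Definition is_min_value (S : set T) (v : T) : Prop := S v /\ lbound S v.

End OptimalValues.

Section Geometry.
Context {R : realType}.

Definition point3 (x y z : R) : 'rV[R]_3 := \row_(k < 3) nth 0 [:: x; y; z] k.

(* The library norm on row vectors is the sup norm. *)
Definition euclid_norm (u : 'rV[R]_3) : R := Num.sqrt (\sum_k u 0 k ^+ 2).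

(* The array lies in the plane z = 0 and its boresight is the z-axis, from
   which the elevation angle is measured. *)
Definition elevation_azimuth (u : 'rV[R]_3) (theta phi : R) : Prop :=
  0 <= theta <= pi /\
  u = euclid_norm u *:
        point3 (sin theta * cos phi) (sin theta * sin phi) (cos theta).

Definition radiation_profile (b theta : R) : R :=
  if 0 <= theta <= pi / 2 then 2 * (b + 1) * cos theta `^ b else 0.

Definition channel_gain (b lambda theta dist : R) : R :=
  Num.sqrt (radiation_profile b theta) * (lambda / (4 * pi * dist)).

End Geometry.

Section Array.
Context {R : realType} {Nd Ne : nat}.
Local Notation N := (Nd * Ne)%N.

(* Element (i, l), counted from 0, has index i * Ne + l in 'I_N, which is
   mxtens_index (i, l). *)

Definition microstrip_mx (alphac betac : R) (rho : 'I_Nd -> 'I_Ne -> R) :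
    'M[R[i]]_N :=
  diag_mx (\row_k let: (i, l) := mxtens_unindex k in
                  cexp (- (rho i l)%:C * (alphac +i* betac))).

Definition element_dist (x : 'I_Nd -> R) (y : 'I_Ne -> R) (p : 'rV[R]_3) i l : R :=
  euclid_norm (p - point3 (x i) (y l) 0).

(* The column vector a whose Hermitian transpose is the row of gains and phases. *)
Definition channel_vec (lambda b : R) (x : 'I_Nd -> R) (y : 'I_Ne -> R)
    (p : 'rV[R]_3) (theta : 'I_Nd -> 'I_Ne -> R) : 'cV[R[i]]_N :=
  (\row_k let: (i, l) := mxtens_unindex k in
          let dist := element_dist x y p i l in
          (channel_gain b lambda (theta i l) dist)%:C
          * cexp (- 'i%C * (2 * pi / lambda * dist)%:C))^t*.

Definition structured (Q : 'M[R[i]]_(N, Nd)) (q : 'I_Nd -> 'I_Ne -> R[i]) : Prop :=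
  forall i l n, Q (mxtens_index (i, l)) n = if i == n then q i l else 0.

Definition P1_feasible : set 'M[R[i]]_(N, Nd) :=
  [set Q | exists2 q, (forall i l, lorentz_set (q i l)) & structured Q q].

Definition P1_objective M (zeta : R) (alpha : 'I_M -> R) (a : 'I_M -> 'cV[R[i]]_N)
    (H : 'M[R[i]]_N) (w1 : 'cV[R[i]]_Nd) (Q : 'M[R[i]]_(N, Nd)) : R[i] :=
  zeta%:C * \sum_m (alpha m)%:C * `| ((a m)^t* *m (H *m Q) *m w1) 0 0 | ^+ 2.

(* mxvec stacks rows, hence the transposes. *)
Definition vec_col m n (A : 'M[R[i]]_(m, n)) : 'cV[R[i]]_(n * m) := (mxvec A^T)^T.

(* Entry (i * Ne + l, i) of Q, i.e. q_{i,l}, sits at this position of vec_col Q. *)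
Definition vec_position (il : 'I_Nd * 'I_Ne) : 'I_(Nd * N) :=
  mxvec_index il.1 (mxtens_index il).

Definition Aq : {set 'I_(Nd * N)} := [set vec_position il | il in [set: 'I_Nd * 'I_Ne]]%SET.

Lemma vec_position_inj : injective vec_position.
Proof.
by move=> il il' /cast_ord_inj/enum_rank_inj/(congr1 snd)/(can_inj (@mxtens_indexK _ _)).
Qed.

Lemma card_Aq : #|Aq| = N.
Proof. by rewrite card_imset ?cardsT ?card_prod ?card_ord //; exact: vec_position_inj. Qed.

(* enum_val on a set of ordinals enumerates it in increasing order. *)
Definition Aq_nth (k : 'I_N) : 'I_(Nd * N) := enum_val (cast_ord (esym card_Aq) k).

Definition keep_Aq (u : 'cV[R[i]]_(Nd * N)) : 'cV[R[i]]_N := rowsub Aq_nth u.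

Definition z_vec (a : 'cV[R[i]]_N) (H : 'M[R[i]]_N) (w1 : 'cV[R[i]]_Nd) :
    'cV[R[i]]_(Nd * N) :=
  (w1^T *t (a^t* *m H))^t*.

Definition A_mx M (zeta : R) (alpha : 'I_M -> R) (a : 'I_M -> 'cV[R[i]]_N)
    (H : 'M[R[i]]_N) (w1 : 'cV[R[i]]_Nd) : 'M[R[i]]_N :=
  - (zeta%:C *: \sum_m (alpha m)%:C *:
       (keep_Aq (z_vec (a m) H w1) *m (keep_Aq (z_vec (a m) H w1))^t*)).

Definition P2_feasible : set 'cV[R[i]]_N :=
  [set qbar | forall k, lorentz_set (qbar k 0)].

Definition P2_objective (A : 'M[R[i]]_N) (qbar : 'cV[R[i]]_N) : R[i] :=
  (qbar^t* *m A *m qbar) 0 0.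

End Array.

(* Main.v *)
Require Import Defs.
From HB Require Import structures.
From mathcomp Require Import all_boot all_order all_algebra.
From mathcomp Require Import complex mxtens.
From mathcomp Require Import all_classical all_reals all_analysis.
Import Order.TTheory GRing.Theory Num.Theory.
Local Open Scope classical_set_scope.
Local Open Scope complex_scope.
Local Open Scope ring_scope.

(* On the nonzero positions of Q the identity vec(A X B) = (B^T (x) A) vec(X)
   turns a^H H Q w into the inner product of the reduced vectors, so that the
   objective of (P1) at Q is minus that of (P2) at the reduced vector, and the
   reduction maps the feasible set of (P1) onto that of (P2). The optimum is
   attained because both objectives are continuous functions of the phases,
   which range over the compact box [0, 2 pi]^N. *)

Local Open Scope sesquilinear_scope.

Section Vectorization.
Context {R : realType}.

(** [vec_col] is indexed by [mxvec_index] and the Kronecker product by [mxtens_index]; this lets the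
    two be multiplied entrywise. *)
Lemma mxvec_index_mxtens m n (i : 'I_m) (j : 'I_n) :
  mxvec_index i j = mxtens_index (i, j).
Proof. by apply: val_inj; rewrite [LHS]val_mxvec_index. Qed.

Lemma vec_colE m n (X : 'M[R[i]]_(m, n)) i j :
  vec_col X (mxvec_index j i) 0 = X i j.
Proof. by rewrite mxE mxvecE mxE. Qed.

Lemma vec_col_mulmx m n p q (A : 'M[R[i]]_(m, n)) (X : 'M[R[i]]_(n, p))
    (B : 'M[R[i]]_(p, q)) :
  vec_col (A *m X *m B) = tensmx B^T A *m vec_col X.
Proof.
apply/matrixP => k o; rewrite ord1 {o}; case/mxvec_indexP: k => j i.
(* Splitting the sum over positions into a sum over pairs [(s, t)] makes both sides the double sum
   of [A i t * X t s * B s j]. *)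
rewrite vec_colE [LHS]mxE [RHS]mxE (reindex _ (curry_mxvec_bij _ _)) /=.
transitivity (\sum_s \sum_t tensmx B^T A (mxvec_index j i) (mxvec_index s t)
                          * vec_col X (mxvec_index s t) 0); last first.
  by rewrite pair_bigA; apply: eq_bigr => -[].
apply: eq_bigr => s _; rewrite mxE mulr_suml; apply: eq_bigr => t _.
rewrite !mxvec_index_mxtens tensmxE -[mxtens_index (s,t)]mxvec_index_mxtens vec_colE mxE.
by rewrite mulrC mulrA.
Qed.

End Vectorization.

Section Reduction.
Context {R : realType} {Nd Ne : nat}.
Local Notation N := (Nd * Ne)%N.
Implicit Types (Q : 'M[R[i]]_(N, Nd)) (qbar : 'cV[R[i]]_N).

Lemma Aq_nth_inj : injective (@Aq_nth Nd Ne).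
Proof. by move=> k k' /enum_val_inj/cast_ord_inj. Qed.

Lemma Aq_nthP k : exists il, Aq_nth k = @vec_position Nd Ne il.
Proof. by have /imsetP[il _ e] := enum_valP (cast_ord (esym card_Aq) k); exists il. Qed.

Lemma vec_position_Aq_nth il : exists k, @vec_position Nd Ne il = Aq_nth k.
Proof.
have il_Aq : vec_position il \in @Aq Nd Ne by exact: imset_f.
exists (cast_ord card_Aq (enum_rank_in il_Aq (vec_position il))).
by rewrite /Aq_nth cast_ordK enum_rankK_in.
Qed.

Lemma sum_Aq_nth (V : nmodType) (F : 'I_(Nd * N) -> V) :
  \sum_(k < N) F (Aq_nth k) = \sum_(s in @Aq Nd Ne) F s.
Proof.
rewrite [RHS]big_enum_val (reindex (cast_ord (esym card_Aq))) //=.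
by exists (cast_ord card_Aq) => k _; rewrite ?cast_ordK ?cast_ordKV.
Qed.

(** A position outside [Aq] lies in column [n] and row [(i, l)] with [i != n], where the structure
    of [Q] forces a zero. *)
Lemma vec_col_structured0 Q q s :
  structured Q q -> s \notin @Aq Nd Ne -> vec_col Q s 0 = 0.
Proof.
move=> Qq; case/mxvec_indexP: s => n k; rewrite vec_colE -[k]mxtens_unindexK.
case: (mxtens_unindex k) => i l; rewrite Qq; case: eqVneq => // <-.
by rewrite /Aq -/(vec_position (i, l)) imset_f.
Qed.

(** Every deleted term has an entry of [v] as a factor, so it suffices that [v] vanishes off [Aq].
    This matters because [z_vec], in the role of [u], is in general nonzero there. *)
Lemma mul_conj_keep_Aq (u v : 'cV[R[i]]_(Nd * N)) :
  (forall s, s \notin @Aq Nd Ne -> v s 0 = 0) ->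
  ((keep_Aq u)^t* *m keep_Aq v) 0 0 = (u^t* *m v) 0 0.
Proof.
move=> v0; rewrite !mxE.
rewrite [RHS](bigID (mem (@Aq Nd Ne))) /= [X in _ + X]big1 ?addr0 => [|s /v0 ->].
  by rewrite -sum_Aq_nth; apply: eq_bigr => k _; rewrite !mxE.
by rewrite mulr0.
Qed.

Lemma received_signalE (a : 'cV[R[i]]_N) (H : 'M[R[i]]_N) (w : 'cV[R[i]]_Nd) Q q :
  structured Q q ->
  (a^t* *m (H *m Q) *m w) 0 0
  = ((keep_Aq (z_vec a H w))^t* *m keep_Aq (vec_col Q)) 0 0.
Proof.
move=> Qq; rewrite mul_conj_keep_Aq => [|s]; last exact: vec_col_structured0 Qq.
(* The received signal is a 1 x 1 matrix, hence its own vectorization, and the vectorization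
   identity applies with [w] as right factor. *)
rewrite trmxCK mulmxA -(vec_colE _ _ _ 0 0) vec_col_mulmx.
by rewrite [mxvec_index 0 0](ord1 (_ : 'I_1)).
Qed.

(** Each rank-one term factors as [(qbar^t* *m z) *m (z^t* *m qbar)], a product of two conjugate
    scalars, hence a squared modulus. *)
Lemma P2_objectiveE M (zeta : R) (alpha : 'I_M -> R) (a : 'I_M -> 'cV[R[i]]_N)
    (H : 'M[R[i]]_N) (w : 'cV[R[i]]_Nd) qbar :
  P2_objective (A_mx zeta alpha a H w) qbar
  = - (zeta%:C * \sum_m (alpha m)%:C
         * `| ((keep_Aq (z_vec (a m) H w))^t* *m qbar) 0 0 | ^+ 2).
Proof.
rewrite /P2_objective /A_mx mulmxN mulNmx mxE -scalemxAr -scalemxAl mxE.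
congr (- (_ * _)); rewrite mulmx_sumr mulmx_suml summxE; apply: eq_bigr => m _.
rewrite -scalemxAr -scalemxAl mxE; congr (_ * _).
set z := keep_Aq _; rewrite (mulmxA _ z) -(mulmxA (_ *m z)) mxE big_ord1 normCK mulrC.
congr (_ * _); rewrite !mxE rmorph_sum; apply: eq_bigr => k _.
by rewrite !mxE rmorphM /= conjCK mulrC.
Qed.

Lemma P1_objectiveE M (zeta : R) (alpha : 'I_M -> R) (a : 'I_M -> 'cV[R[i]]_N)
    (H : 'M[R[i]]_N) (w : 'cV[R[i]]_Nd) Q q :
  structured Q q ->
  P1_objective zeta alpha a H w Q
  = zeta%:C * \sum_m (alpha m)%:C
         * `| ((keep_Aq (z_vec (a m) H w))^t* *m keep_Aq (vec_col Q)) 0 0 | ^+ 2.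
Proof.
move=> Qq; rewrite /P1_objective; congr (_ * _); apply: eq_bigr => m _.
by rewrite (received_signalE _ _ _ _ _ Qq).
Qed.

Lemma keep_Aq_image :
  [set keep_Aq (vec_col Q) | Q in @P1_feasible R Nd Ne] = P2_feasible.
Proof.
apply/seteqP; split=> [_ [Q [q Lq Qq] <-] k|qbar Lqbar].
  by rewrite mxE; have [[i l] ->] := Aq_nthP k; rewrite vec_colE Qq eqxx; exact: Lq.
(* For surjectivity, [kof] inverts the enumeration of [Aq]: it gives the rank of the position of
   element [(i, l)], obtained by choice rather than computed. *)
pose kof il := projT1 (cid (vec_position_Aq_nth il)).
have kofE il : vec_position il = Aq_nth (kof il) by rewrite /kof; case: cid.
pose q i l := qbar (kof (i, l)) 0.
pose Q : 'M[R[i]]_(N, Nd) := \matrix_(k, n)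
  if (mxtens_unindex k).1 == n then q n (mxtens_unindex k).2 else 0.
have Qq : structured Q q.
  by move=> i l n; rewrite mxE mxtens_indexK /=; case: eqVneq => // ->.
exists Q; first by exists q => // i l; exact: Lqbar.
apply/matrixP => k o; rewrite ord1 {o} mxE.
have [[i l] kE] := Aq_nthP k; rewrite kE vec_colE Qq eqxx /q.
by congr (qbar _ _); apply: Aq_nth_inj; rewrite -kofE.
Qed.

End Reduction.

Section LorentzianMaximum.
Import numFieldNormedType.Exports.
Context {R : realType}.
Local Notation lorentz phi := (('i%C + cexp ('i%C * phi%:C)) / 2).

(** Cartesian form of the circle of centre ['i / 2] and radius 1/2, which reduces continuity in the
    phase to that of [cos] and [sin]. *)
Lemma lorentzE (phi : R) : lorentz phi = (cos phi / 2) +i* ((1 + sin phi) / 2).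
Proof.
rewrite /cexp /= !mul0r !mulr0 subrr mul1r ?addr0 ?add0r expR0 mul1r.
have -> : 2 = (2 : R)%:C by rewrite rmorphMn.
rewrite -fmorphV; apply/eqP; rewrite eq_complex /= !mulr0 subr0 !add0r.
by rewrite !eqxx.
Qed.

Lemma Re_sum (I : Type) (r : seq I) (F : I -> R[i]) :
  complex.Re (\sum_(i <- r) F i) = \sum_(i <- r) complex.Re (F i).
Proof. by apply: big_morph => // -[a b] [c d]. Qed.

Lemma Im_sum (I : Type) (r : seq I) (F : I -> R[i]) :
  complex.Im (\sum_(i <- r) F i) = \sum_(i <- r) complex.Im (F i).
Proof. by apply: big_morph => // -[a b] [c d]. Qed.

Lemma quadratic_max n M (beta : 'I_M -> R) (c : 'I_M -> 'rV[R[i]]_n) :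
  exists v : R, is_max_value
    [set \sum_m (beta m)%:C * `| (c m *m qbar) 0 0 | ^+ 2
       | qbar in [set u : 'cV[R[i]]_n | forall k, lorentz_set (u k 0)]] v%:C.
Proof.
pose q (t : 'rV[R]_n) : 'cV[R[i]]_n := \col_k (lorentz (t 0 k)).
pose D := [set t : 'rV[R]_n | forall k, `[0, 2 * pi]%classic (t 0 k)].
(* The extreme value theorem is applied to a real-valued function, so the squared moduli are written
   with real and imaginary parts; [fE] returns to [R[i]]. *)
pose f t := \sum_m beta m * (complex.Re ((c m *m q t) 0 0) ^+ 2
                             + complex.Im ((c m *m q t) 0 0) ^+ 2).
have fE t : (f t)%:C = \sum_m (beta m)%:C * `| (c m *m q t) 0 0 | ^+ 2.
  rewrite rmorph_sum; apply: eq_bigr => m _.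
  by rewrite -add_Re2_Im2 rmorphM.
have sumc (I : Type) (r : seq I) (F : I -> 'rV[R]_n -> R) :
    (forall i, continuous (F i)) -> continuous (fun t => \sum_(i <- r) F i t).
  by move=> Fc; apply: continuous_big => // x; exact: add_continuous.
have addc (g h : 'rV[R]_n -> R) :
    continuous g -> continuous h -> continuous (fun t => g t + h t).
  by move=> gc hc t; apply: continuousD; [exact: gc|exact: hc].
have mulc (g h : 'rV[R]_n -> R) :
    continuous g -> continuous h -> continuous (fun t => g t * h t).
  by move=> gc hc t; apply: continuousM; [exact: gc|exact: hc].
have sqrc (g : 'rV[R]_n -> R) : continuous g -> continuous (fun t => g t ^+ 2).
  by move=> gc; exact: (mulc g g gc gc).
have cstc (a : R) : continuous (fun _ : 'rV[R]_n => a) by move=> t; exact: cst_continuous.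
have cosc (k : 'I_n) : continuous (fun t : 'rV[R]_n => cos (t 0 k)).
  by move=> t; apply: continuous_comp; [exact: coord_continuous|exact: continuous_cos].
have sinc (k : 'I_n) : continuous (fun t : 'rV[R]_n => sin (t 0 k)).
  by move=> t; apply: continuous_comp; [exact: coord_continuous|exact: continuous_sin].
(* Common shape of the real and imaginary parts of a coefficient times a Lorentzian response; [ReE]
   and [ImE] below are put in this form. *)
have lorc (a b : R) (k : 'I_n) :
    continuous (fun t : 'rV[R]_n => a * (cos (t 0 k) / 2) + b * ((1 + sin (t 0 k)) / 2)).
  by apply: (addc); apply: (mulc) => //; apply: (mulc) => //; exact: addc.
have ReE m t : complex.Re ((c m *m q t) 0 0)
    = \sum_k (complex.Re (c m 0 k) * (cos (t 0 k) / 2)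
             + (- complex.Im (c m 0 k)) * ((1 + sin (t 0 k)) / 2)).
  rewrite mxE Re_sum; apply: eq_bigr => k _.
  by rewrite mxE lorentzE mulNr; case: (c m 0 k).
have ImE m t : complex.Im ((c m *m q t) 0 0)
    = \sum_k (complex.Im (c m 0 k) * (cos (t 0 k) / 2)
             + complex.Re (c m 0 k) * ((1 + sin (t 0 k)) / 2)).
  rewrite mxE Im_sum; apply: eq_bigr => k _.
  by rewrite mxE lorentzE [RHS]addrC; case: (c m 0 k).
have Rec m : continuous (fun t => complex.Re ((c m *m q t) 0 0)).
  by rewrite (funext (ReE m)); apply: sumc => k; exact: lorc.
have Imc m : continuous (fun t => complex.Im ((c m *m q t) 0 0)).
  by rewrite (funext (ImE m)); apply: sumc => k; exact: lorc.
have fc : continuous f.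
  by apply: (sumc) => m; apply: (mulc) => //; apply: (addc); exact: sqrc.
have D0 : D !=set0.
  by exists 0 => k; rewrite /= mxE in_itv /= lexx mulr_ge0 ?pi_ge0.
have Dc : compact D.
  by apply: (@rV_compact R n (fun=> `[0, 2 * pi]%classic)) => _; exact: segment_compact.
have [t0 /set_mem Dt0 max_t0] := EVT_max_rV D0 Dc (continuous_subspaceT fc).
exists (f t0); split.
  exists (q t0); last by rewrite fE.
  by move=> k; exists (t0 0 k); [exact: Dt0|rewrite mxE].
move=> _ [u Lu <-].
(* Choosing a phase for each entry writes any feasible [u] as [q] of a point of the box, so the
   maximum over phases bounds all feasible values. *)
have /choice[phi phiP] : forall k, exists p : R,
    `[0, 2 * pi]%classic p /\ lorentz p = u k 0.
  by move=> k; have [p Dp pE] := Lu k; exists p.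
have -> : u = q (\row_k phi k).
  by apply/matrixP => k o; rewrite ord1 !mxE; have [_ ->] := phiP k.
rewrite -fE lecR; apply: max_t0; apply/mem_set => k.
by rewrite mxE; have [] := phiP k.
Qed.

End LorentzianMaximum.

Theorem theorem1 (R : realType) (Nd Ne M : nat)
  (hNd : (1 <= Nd)%N) (hNe : (1 <= Ne)%N) (hM : (1 <= M)%N)
  (zeta : R) (hzeta : 0 < zeta < 1)
  (alpha : 'I_M -> R)
  (alphac betac : R) (rho : 'I_Nd -> 'I_Ne -> R)
  (lambda : R) (hlambda : 0 < lambda) (b : R)
  (x : 'I_Nd -> R) (y : 'I_Ne -> R) (p : 'I_M -> 'rV[R]_3)
  (hdist : forall i l m, 0 < element_dist x y (p m) i l)
  (theta phi : 'I_M -> 'I_Nd -> 'I_Ne -> R)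
  (hangle : forall m i l,
     elevation_azimuth (p m - point3 (x i) (y l) 0) (theta m i l) (phi m i l))
  (w1 : 'cV[R[i]]_Nd) :
  let H := microstrip_mx alphac betac rho in
  let a m := channel_vec lambda b x y (p m) (theta m) in
  exists v : R,
    is_max_value [set P1_objective zeta alpha a H w1 Q | Q in P1_feasible] v%:C /\
    is_min_value [set P2_objective (A_mx zeta alpha a H w1) qbar | qbar in P2_feasible]
      (- v)%:C.
Proof.
move=> H a.
(* [zeta] is absorbed into the weights to match the form of [quadratic_max]. *)
pose F (qbar : 'cV[R[i]]_(Nd * Ne)) : R[i] := \sum_m (zeta * alpha m)%:C
  * `| ((keep_Aq (z_vec (a m) H w1))^t* *m qbar) 0 0 | ^+ 2.
have FE qbar : F qbar = zeta%:C * \sum_m (alpha m)%:C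
    * `| ((keep_Aq (z_vec (a m) H w1))^t* *m qbar) 0 0 | ^+ 2.
  by rewrite mulr_sumr; apply: eq_bigr => m _; rewrite rmorphM mulrA.
(* Both problems now range over [P2_feasible], with objectives [F] and [- F], so one maximizer [u]
   serves both. *)
have P1E : [set P1_objective zeta alpha a H w1 Q | Q in P1_feasible]
    = [set F qbar | qbar in P2_feasible].
  rewrite -keep_Aq_image image_comp; apply: eq_imagel => Q [q _ Qq] /=.
  by rewrite FE (P1_objectiveE _ _ _ _ _ _ _ _ Qq).
have [v [[u Lu Fu] max_v]] := quadratic_max _ _ (fun m => zeta * alpha m)
  (fun m => (keep_Aq (z_vec (a m) H w1))^t*).
exists v; rewrite P1E; split; first by split=> //; exists u.
split; first by exists u => //; rewrite P2_objectiveE -FE [F u]Fu rmorphN.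
move=> _ [qbar Lqbar <-]; rewrite P2_objectiveE -FE rmorphN lerN2.
by apply: max_v; exists qbar.
Qed.
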